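(* Let $q\ge3$ be an integer. Assume DRH(A) for $L(s,\chi)$ and $L(\frac12,\chi)\neq0$ for the nontrivial Dirichlet characters $\chi$ modulo $q$. If $m(\sigma_a)=0$ for any $a\in(\mathbb Z/q\mathbb Z)^\times$, then there exist no biases between any pair of quadratic residues modulo $q$, and between any pair of quadratic non-residues modulo $q$; that is, whenever $a,b\in(\mathbb Z/q\mathbb Z)^\times$ are both quadratic residues or both quadratic non-residues, $$\pi_{\frac12}(x;q,b)-\pi_{\frac12}(x;q,a)=O(1)\qquad(x\to\infty).$$
   Context: For $a\in(\mathbb Z/q\mathbb Z)^\times$, $\pi_s(x;q,a):=\sum_{p<x,\ p\equiv a\ (\mathrm{mod}\ q)}p^{-s}$, the sum over primes $p$. Let $G=\mathrm{Gal}(\mathbb Q(\zeta_q)/\mathbb Q)\cong(\mathbb Z/q\mathbb Z)^\times$, with $a\in(\mathbb Z/q\mathbb Z)^\times$ corresponding to the Artin symbol $\sigma_a=\left(\frac{\mathbb Q(\zeta_q)/\mathbb Q}{(a)}\right)$; characters of $G$ are identified with Dirichlet characters modulo $q$. For a nontrivial Dirichlet character $\chi$ modulo $q$, $m_\chi=\mathrm{ord}_{s=1/2}L(s,\chi)$, and $m(\sigma_a)=\sum_{\chi\ne\mathbf 1}\chi(a)m_\chi$, the sum running over nontrivial Dirichlet characters modulo $q$. DRH(A) for $L(s,\chi)$ (the Deep Riemann Hypothesis (A)) is the statement that the limit $$\lim_{x\to\infty}\left((\log x)^{m_\chi}\prod_{p\le x:\,\text{prime}}\left(1-\chi(p)p^{-1/2}\right)^{-1}\right)$$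 exists and is nonzero. A quadratic residue modulo $q$ is an element of $((\mathbb Z/q\mathbb Z)^\times)^2$; a quadratic non-residue is an element of $(\mathbb Z/q\mathbb Z)^\times$ that is not a quadratic residue. In general, there are no biases between two sets of primes $P_1,P_2$ with $\delta=\lim_{x\to\infty}|P_1(x)|/|P_2(x)|$ (where $P_i(x)$ is the set of $p\in P_i$ with $p\le x$) if $\sum_{p\in P_1(x)}p^{-1/2}-\delta\sum_{p\in P_2(x)}p^{-1/2}=O(1)$; for two residue classes in $(\mathbb Z/q\mathbb Z)^\times$ one has $\delta=1$. *)

(* Defs.v *)
From HB Require Import structures.
From mathcomp Require Import all_boot all_order all_algebra all_fingroup.
From mathcomp Require Import complex.
From mathcomp Require Import all_classical all_reals all_analysis.
Import Order.TTheory GRing.Theory Num.Theory numFieldNormedType.Exports.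

Set Implicit Arguments.
Unset Strict Implicit.
Unset Printing Implicit Defensive.

Local Open Scope classical_set_scope.
Local Open Scope ring_scope.
Local Open Scope complex_scope.

(* [R[i]] itself has no canonical topology; its regular-algebra alias
   [R[i]^o] carries the norm topology, and [derivable] there is complex
   differentiability. *)
Notation Cplx R := (R[i]^o).

Section ComplexAnalysis.
Context {R : realType}.

(* exp (u + i v) = e^u (cos v + i sin v) *)
Definition cexp (z : Cplx R) : Cplx R :=
  (expR (complex.Re z))%:C * (cos (complex.Im z) +i* sin (complex.Im z)).

Definition holomorphic_at (g : Cplx R -> Cplx R) (s0 : Cplx R) : Prop :=
  \forall s \near s0, derivable g s 1.

Definition has_order (f : Cplx R -> Cplx R) (s0 : Cplx R) (n : nat) : Prop :=
  exists g : Cplx R -> Cplx R,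
    [/\ holomorphic_at g s0,
        g s0 != 0
      & \forall s \near s0, f s = (s - s0) ^+ n * g s].

(* Order of vanishing at [s0]. For [f] holomorphic near [s0] and not locally
   zero there is exactly one [n] with [has_order f s0 n]; the default value is
   only used outside this situation. *)
Definition ord_at (f : Cplx R -> Cplx R) (s0 : Cplx R) : nat :=
  xget 0%N [set n | has_order f s0 n].

End ComplexAnalysis.

(* ['Z_q] is the ring of integers modulo [q] only for [1 < q]. *)
Section Dirichlet.
Context {R : realType} {q : nat}.
Implicit Types (chi : 'Z_q -> Cplx R) (a b : {unit 'Z_q}).

(* A homomorphism ('Z_q)^* -> C^*, extended by zero to 'Z_q. *)
Definition dirichlet_character chi : Prop :=
  [/\ chi 1 = 1,
      forall x y, chi (x * y) = chi x * chi y
    & forall x, (chi x != 0) = (x \is a GRing.unit)].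

Definition principal_character : 'Z_q -> Cplx R :=
  fun x => (x \is a GRing.unit)%:R.

Definition nontrivial_characters : set ('Z_q -> Cplx R) :=
  [set chi | dirichlet_character chi /\ chi <> principal_character].

(* L(s, chi) as the sum in the natural order of sum_{n >= 1} chi(n) n^{-s},
   with n^{-s} = exp(- s log n). For nontrivial [chi] the series converges
   (conditionally) to the holomorphic function L(s, chi) on the whole half-plane
   Re s > 0, in particular around s = 1/2; nothing is claimed for Re s <= 0. *)
Definition dirichlet_L chi (s : Cplx R) : Cplx R :=
  limn (fun N : nat =>
    (\sum_(1 <= n < N.+1) chi n%:R * cexp (- s * (ln n%:R)%:C) : Cplx R)).

Definition m_chi chi : nat := ord_at (dirichlet_L chi) 2^-1.

(* m(sigma_a). The set of nontrivial characters is finite, so this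
   finite-support sum is the sum over all of them. *)
Definition m_sigma a : Cplx R :=
  \sum_(chi \in nontrivial_characters) chi (val a) * (m_chi chi)%:R.

(* (log x)^{m_chi} * prod_{p <= x} (1 - chi(p) p^{-1/2})^{-1} *)
Definition DRH_product chi (x : R) : Cplx R :=
  ((ln x) ^+ m_chi chi)%:C *
  \prod_(0 <= p < (Num.truncn x).+1 | prime p && (p%:R <= x))
     (1 - chi p%:R * (p%:R `^ (- 2^-1))%:C)^-1.

Definition DRH_A chi : Prop :=
  exists l : Cplx R, l != 0 /\ DRH_product chi x @[x --> +oo] --> l.

Definition pi_s (s x : R) a : R :=
  \sum_(0 <= p < (Num.truncn x).+1 |
        [&& prime p, p%:R < x & (p%:R : 'Z_q) == val a]) p%:R `^ (- s).

Definition quadratic_residue a : Prop := exists b, a = (b ^+ 2)%g.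

End Dirichlet.

(* Main.v *)
Require Import Defs.
From HB Require Import structures.
From mathcomp Require Import all_boot all_order all_algebra all_fingroup.
From mathcomp Require Import cyclic separable cyclotomic complex ring lra.
From mathcomp Require Import all_classical all_reals all_analysis.
Import Order.TTheory GRing.Theory Num.Theory numFieldNormedType.Exports.
Local Open Scope classical_set_scope.
Local Open Scope ring_scope.

(* As [L(1/2, chi) != 0], every [m_chi] vanishes and the Euler product at 1/2
   converges to a nonzero number. Its logarithm is, up to an absolutely convergent
   sum of cubes, [sum (chi(p) p^{-1/2} + chi(p)^2 p^{-1} / 2)], which is therefore
   bounded. If [chi^2] is nontrivial, the same fact for [chi^2] and partial
   summation show that [sum chi(p)^2 / p] is bounded; hence
   [sum chi(p) p^{-1/2}] is bounded unless [chi^2 = 1], in which case it is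
   [- 1/2 sum 1/p + O(1)] whatever [chi] is. Expanding the difference
   of the indicators of [b] and [a] in characters, the coefficient of [sum 1/p] is
   proportional to the difference of the numbers of square roots of [b] and [a],
   which is zero. *)

(** * Real-valued modulus, complex exponential and a third-order estimate *)

Section ComplexNorm.
Context {R : realType}.
Implicit Types (z w : R[i]) (x : R).
Local Open Scope complex_scope.

(** The norm [|z|] lives in [R[i]]; this copy is real-valued, so that [lra] and [nra] apply to
    it. *)
Definition abs z : R := ComplexField.Normc.normc z.

Lemma normE z : `|z| = (abs z)%:C.
Proof. by case: z. Qed.

Lemma abs_ge0 z : 0 <= abs z.
Proof. by rewrite -lecR -normE normr_ge0. Qed.

Lemma absD z w : abs (z + w) <= abs z + abs w.
Proof. exact: le_normcD. Qed.

Lemma absM z w : abs (z * w) = abs z * abs w.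
Proof. exact: ComplexField.Normc.normcM. Qed.

Lemma absN z : abs (- z) = abs z.
Proof. exact: normcN. Qed.

Lemma absB z w : abs (z - w) = abs (w - z).
Proof. by rewrite -absN opprB. Qed.

Lemma absV z : abs z^-1 = (abs z)^-1.
Proof. exact: ComplexField.Normc.normcV. Qed.

Lemma abs0 : abs 0 = 0. Proof. exact: ComplexField.Normc.normc0. Qed.
Lemma abs1 : abs 1 = 1. Proof. exact: ComplexField.Normc.normc1. Qed.

Lemma abs_gt0 z : (0 < abs z) = (z != 0).
Proof. by rewrite -normr_gt0 normE ltcR. Qed.

Lemma absX z n : abs (z ^+ n) = abs z ^+ n.
Proof. by elim: n => [|n IH]; rewrite ?expr0 ?abs1// !exprS absM IH. Qed.

Lemma absR x : abs x%:C = `|x|.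
Proof. by rewrite /abs /= expr0n/= addr0 sqrtr_sqr. Qed.

Lemma abs_half : abs 2^-1 = 2^-1.
Proof.
have -> : 2^-1 = (2^-1)%:C :> R[i] by rewrite fmorphV rmorph_nat.
by rewrite absR ger0_norm ?invr_ge0.
Qed.

Lemma abs_sqr z : abs z ^+ 2 = complex.Re z ^+ 2 + complex.Im z ^+ 2.
Proof. by case: z => a b; rewrite sqr_sqrtr ?addr_ge0 ?sqr_ge0. Qed.

Lemma abs_Re z : `|complex.Re z| <= abs z.
Proof.
by rewrite -(@ler_sqr _ `|_|) ?nnegrE ?abs_ge0// abs_sqr real_normK ?num_real// lerDl sqr_ge0.
Qed.

Lemma abs_Im z : `|complex.Im z| <= abs z.
Proof.
by rewrite -(@ler_sqr _ `|_|) ?nnegrE ?abs_ge0// abs_sqr real_normK ?num_real// lerDr sqr_ge0.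
Qed.

Lemma abs_le_ReIm z : abs z <= `|complex.Re z| + `|complex.Im z|.
Proof.
rewrite -(@ler_sqr _ (abs z)) ?nnegrE ?abs_ge0 ?addr_ge0// abs_sqr sqrrD !real_normK ?num_real//.
by rewrite addrAC lerDl mulrn_wge0// mulr_ge0.
Qed.

Lemma abs_sum (I : Type) (r : seq I) (P : pred I) (F : I -> R[i]) :
  abs (\sum_(i <- r | P i) F i) <= \sum_(i <- r | P i) abs (F i).
Proof.
elim/big_rec2: _ => [|i y1 y2 _ H]; first by rewrite abs0.
by apply: le_trans (absD _ _) _; rewrite lerD2l.
Qed.

(* [cexp] with its arguments in the ring [R[i]] rather than in its
   regular-algebra alias. *)
Definition cxp : R[i] -> R[i] := @cexp R.

Lemma cxpD (z w : R[i]) : cxp (z + w) = cxp z * cxp w.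
Proof.
case: z w => [a b] [c d]; rewrite /cxp/cexp /= expRD cosD sinD.
apply/eqP; rewrite eq_complex /=; apply/andP; split; apply/eqP; ring.
Qed.

Lemma cxp0 : cxp 0 = 1 :> R[i].
Proof.
by rewrite /cxp/cexp /= expR0 cos0 sin0; apply/eqP; rewrite eq_complex /=; apply/andP; split; apply/eqP; ring.
Qed.

Lemma abs_cxp z : abs (cxp z) = expR (complex.Re z).
Proof.
rewrite /cxp/cexp absM absR gtr0_norm ?expR_gt0//.
by rewrite /abs /= cos2Dsin2 sqrtr1 mulr1.
Qed.

(** If [1 < |Im z| <= 2], then [cos (Im z) < cos 1], which keeps [cxp z] away from 1. Improving the
    bound 2 to 1 is what lets a partial sum be followed step by step on one branch of the
    logarithm. *)
Lemma cxp_near1 : exists2 e : R, 0 < e & forall z, abs (cxp z - 1) <= e ->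
  `|complex.Im z| <= 2 -> `|complex.Re z| <= 1 /\ `|complex.Im z| <= 1.
Proof.
have c0 := @cos1_gt0 R.
have c1 : cos 1 < 1 :> R.
  rewrite -[ltRHS]cos0 ltr_cos ?ltr01// in_itv/= ?lexx ?pi_ge0//.
  by rewrite ler01 (le_trans _ (pi_ge2 R))//; lra.
(* With this value [d], [(1 + d) * cos 1 < 1 - d], which rules out a large imaginary part; also
   [d < 1/4], so [1 - d] and [1 + d] lie between [1/e] and [e]. *)
exists ((1 - cos 1) / 4); first lra.
move=> z hz hI; have e2 : 2 <= expR 1 :> R by apply: le_trans (expR_ge1Dx 1); lra.
have hR : `|expR (complex.Re z) - 1| <= (1 - cos 1) / 4.
  apply: le_trans hz; rewrite -abs_cxp ler_norml; apply/andP; split.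
    have := absD (1 - cxp z) (cxp z); rewrite subrK abs1 (absB 1); lra.
  have := absD (cxp z - 1) 1; rewrite subrK abs1; lra.
move: hR; rewrite ler_norml => /andP[hR1 hR2]; split.
  rewrite ler_norml -ler_expR -(@ler_expR _ (complex.Re z)) expRN; apply/andP; split; last lra.
  have : (expR 1)^-1 <= 2^-1 :> R by rewrite lef_pV2 ?posrE ?expR_gt0.
  lra.
rewrite leNgt; apply/negP => h.
have hc : cos (complex.Im z) < cos 1.
  have [p2 n0] := (pi_ge2 R, normr_ge0 (complex.Im z)).
  by rewrite -(cos_norm (complex.Im z)) ltr_cos// in_itv/=; lra.
have := le_trans (abs_Re _) hz.
rewrite ler_norml => /andP[+ _].
rewrite /cxp/cexp; case: z hc hR1 hR2 {h hI hz} => a b /= hc h1 h2.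
rewrite mul0r subr0 => h3.
have e0 := expR_gt0 a.
nra.
Qed.

(* With [z = x + i y], [u + i v = t z + t^2 z^2 / 2] and
   [phi = al Re Phi + be Im Phi] for [Phi t = (1 - t z) exp (t z + t^2 z^2 / 2)],
   whose derivative is [- t^2 z^3 exp (t z + t^2 z^2 / 2)]. *)
Section MVT.
Variables (x y al be : R).
Let u (t : R) : R := t * x + t ^+ 2 * ((x ^+ 2 - y ^+ 2) / 2).
Let v (t : R) : R := t * y + t ^+ 2 * (x * y).
Let phi (t : R) : R := expR (u t) *
  (al * ((1 - t * x) * cos (v t) + t * y * sin (v t))
 + be * ((1 - t * x) * sin (v t) - t * y * cos (v t))).
Let dphi (t : R) : R := - t ^+ 2 * expR (u t) *
  (al * ((x ^+ 3 - 3 * x * y ^+ 2) * cos (v t) - (3 * x ^+ 2 * y - y ^+ 3) * sin (v t))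
 + be * ((x ^+ 3 - 3 * x * y ^+ 2) * sin (v t) + (3 * x ^+ 2 * y - y ^+ 3) * cos (v t))).

Lemma twisted_exp_derive (t : R) : is_derive t 1 phi (dphi t).
Proof.
have du : is_derive t 1 u (x + t * (x ^+ 2 - y ^+ 2)).
  apply: is_derive_eq; rewrite /GRing.scale /=.
  by field.
have dv : is_derive t 1 v (y + 2 * t * (x * y)).
  apply: is_derive_eq; rewrite /GRing.scale /=; ring.
have dE := is_derive1_comp (is_derive_expR (u t)) du.
have dC := is_derive1_comp (is_derive_cos (v t)) dv.
have dS := is_derive1_comp (is_derive_sin (v t)) dv.
(* The same function in point-free form, from which its derivative is inferred structurally. *)
rewrite -[phi]/((expR \o u) * (al *: ((fun t => 1 - t * x) * (cos \o v) + (fun t => t * y) * (sin \o v))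
  + be *: ((fun t => 1 - t * x) * (sin \o v) - (fun t => t * y) * (cos \o v)))).
apply: is_derive_eq; rewrite /GRing.scale /= /dphi.
set w := (X in X * (_ * (x + _))).
have -> : w = al * ((1 - t * x) * cos (v t) + t * y * sin (v t))
            + be * ((1 - t * x) * sin (v t) - t * y * cos (v t)) by [].
ring.
Qed.

Lemma twisted_exp_mvt : exists2 t, 0 <= t <= 1 & phi 1 - phi 0 = dphi t.
Proof.
have [t _||t] := @MVT_segment R phi dphi 0 1 ler01.
- exact: twisted_exp_derive.
- apply: continuous_subspaceT => t.
  apply/differentiable_continuous/derivable1_diffP.
  by have [] := twisted_exp_derive t.
- by rewrite in_itv /= subr0 mulr1; exists t.
Qed.
End MVT.

(** The exponent cancels [log (1 - z)] up to second order. The mean value theorem fails for complex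
    values, so it is applied to the real functionals [al Re + be Im]; taking the real and the
    imaginary part separately costs the factor 2. *)
Lemma twisted_exp_le z : abs z ^+ 2 <= 2^-1 ->
  abs ((1 - z) * cxp (z + z ^+ 2 / 2) - 1) <= 2 * expR 1 * abs z ^+ 3.
Proof.
move=> hz; set F := _ - 1.
suff main al be : al ^+ 2 + be ^+ 2 = 1 ->
    `|al * complex.Re F + be * complex.Im F| <= expR 1 * abs z ^+ 3.
  have h1 := main 1 0; have h2 := main 0 1.
  apply: le_trans (abs_le_ReIm _) _.
  move: h1 h2; rewrite !mul1r !mul0r addr0 add0r expr1n expr0n/= addr0 add0r => /(_ erefl) h1 /(_ erefl).
  lra.
move=> ab1; rewrite {}/F; move: hz; rewrite abs_sqr -absX.
case: z => x y hz; set r := abs (_ ^+ 3).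
rewrite [X in cxp X](_ : _ = (x + (x ^+ 2 - y ^+ 2) / 2) +i* (y + x * y)); last first.
  by apply/eqP; rewrite eq_complex /=; apply/andP; split; apply/eqP; field.
rewrite /= in hz.
have [t /andP[t0 t1]] := twisted_exp_mvt x y al be.
rewrite !mul0r !mul1r expr1n !mul1r expr0n/= !mul0r addr0 cos0 sin0 expR0 => E.
set F := (X in `|X|); set d := (X in _ = X) in E.
have {E} -> : F = d by rewrite -E /F /cxp /cexp /=; ring.
rewrite /d {F d}.
set u := expR _; set v := t * y + _.
(* The derivative is [- t^2 exp u] times [al Re c + be Im c]; Cauchy-Schwarz bounds the latter by
   [abs c], the cube of the modulus of [z]. *)
pose c : R[i] := (x +i* y) ^+ 3 * (cos v +i* sin v).
have -> : r = abs c.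
  by rewrite /r [RHS]absM (_ : abs (_ +i* _) = 1) ?mulr1// /abs /= cos2Dsin2 sqrtr1.
rewrite (_ : al * _ + be * _ = al * complex.Re c + be * complex.Im c); last first.
  by rewrite /c /=; ring.
have hc : `|al * complex.Re c + be * complex.Im c| <= abs c.
  rewrite -(@ler_sqr _ `|_|) ?nnegrE ?abs_ge0// abs_sqr real_normK ?num_real//.
  have := sqr_ge0 (al * complex.Im c - be * complex.Re c).
  nra.
rewrite !normrM normrN normrX (ger0_norm t0) gtr0_norm ?expR_gt0//.
apply: ler_pM => //; first by rewrite mulr_ge0 ?sqr_ge0// expR_ge0.
rewrite -[leRHS]mul1r ler_pM ?sqr_ge0 ?expR_ge0 ?exprn_ile1//.
rewrite ler_expR.
have [x1 y1] := (sqr_ge0 x, sqr_ge0 y).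
(* Together with [x^2 / 2 <= 1/4] this bounds the exponent by 1. *)
have : x <= 3 / 4 by have := sqr_ge0 (x - 3 / 4); nra.
nra.
Qed.
End ComplexNorm.

(** * From a convergent product to a bounded logarithm *)

Section LogBounded.
Context {R : realType}.

Lemma abs_mul_sub1 (a b : R[i]) : abs (a * b - 1) <= abs (a - 1) * abs b + abs (b - 1).
Proof.
rewrite -absM (_ : a * b - 1 = (a - 1) * b + (b - 1)); last by ring.
exact: absD.
Qed.

Lemma abs_prod_sub1 (F : nat -> R[i]) (e : nat -> R) m n :
  (forall i, abs (F i - 1) <= e i) ->
  abs (\prod_(m <= i < n) F i - 1) <= expR (\sum_(m <= i < n) e i) - 1.
Proof.
move=> Fe; have [mn|nm] := leqP m n; last first.
  by rewrite !big_geq ?(ltnW nm)// subrr abs0 expR0 subrr.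
elim: n mn => [|n IH] mn.
  by rewrite !big_geq// subrr abs0 expR0 subrr.
move: mn; rewrite leq_eqVlt => /orP[/eqP<-|mn].
  by rewrite !big_geq// subrr abs0 expR0 subrr.
rewrite !big_nat_recr//= expRD.
apply: le_trans (abs_mul_sub1 _ _) _.
have h1 := IH mn; have h2 := Fe n; have h3 := expR_ge1Dx (e n).
have h4 : abs (F n) <= 1 + e n by have := absD (F n - 1) 1; rewrite subrK abs1; lra.
have h5 := abs_ge0 (F n - 1); have h6 := abs_ge0 (F n).
have h7 : 1 <= expR (\sum_(m <= i < n) e i) :> R.
  by have := le_trans (abs_ge0 _) h1; lra.
have h8 := abs_ge0 (\prod_(m <= i < n) F i - 1).
nra.
Qed.

(** Since [cxp (w n) = F n * (1 - z n)^-1], the exponential of an increment of the sums [W] is a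
    tail product of the [F n], close to 1 because the cubes are summable, times a quotient of
    partial products, close to 1 because their limit is nonzero. *)
Lemma euler_log_bounded (z : nat -> R[i]) (l : Cplx R) :
  (forall n, abs (z n) ^+ 2 <= 2^-1) ->
  cvgn (series (fun n => abs (z n) ^+ 3)) ->
  l != 0 ->
  (\prod_(0 <= n < N) (1 - z n)^-1 : Cplx R) @[N --> \oo] --> l ->
  exists C : R, forall N, abs (\sum_(0 <= n < N) (z n + z n ^+ 2 / 2)) <= C.
Proof.
move=> z2 z3 l0 Pl.
have [e e0 He] := @cxp_near1 R.
(* Two factors within [eta <= 1] of 1 have a product within [eta * (1 + eta) + eta <= 3 * eta <= e]
   of 1. *)
pose eta := Num.min (e / 3) 1.
have [eta0 [eta1 etae]] : 0 < eta /\ (eta <= 1 /\ 3 * eta <= e).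
  rewrite /eta lt_min ge_min lexx orbT ltr01 andbT divr_gt0//; split=> //; split=> //.
  by have : Num.min (e / 3) 1 <= e / 3; [rewrite ge_min lexx|lra].
have absl : 0 < abs l by rewrite abs_gt0.
pose w n := z n + z n ^+ 2 / 2.
pose F n := (1 - z n) * cxp (w n).
pose P N := \prod_(0 <= n < N) (1 - z n)^-1.
have z1 n : 1 - z n != 0.
  rewrite -abs_gt0; have := absD (1 - z n) (z n); rewrite subrK abs1.
  by have := z2 n; have := abs_ge0 (z n); nra.
have w1 n : abs (w n) <= 1.
  apply: le_trans (absD _ _) _; rewrite absM absX abs_half.
  by have := z2 n; have := abs_ge0 (z n); nra.
have [N1 HN1] : exists N1, forall m n, (N1 <= m)%N ->
    abs (\prod_(m <= i < n) F i - 1) <= eta.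
  pose c := fun n => abs (z n) ^+ 3.
  have cnd : nondecreasing_seq (series c).
    by apply: nondecreasing_series => i _ _; rewrite exprn_ge0 ?abs_ge0.
  have K0 : 0 < 2 * expR 1 :> R by rewrite mulr_gt0 ?expR_gt0.
  have ln0 : 0 < ln (1 + eta) by rewrite ln_gt0// ltrDl.
  (* With this tail bound the exponent in [abs_prod_sub1] is at most [ln (1 + eta)]. *)
  have /cvgrPdist_le/(_ (ln (1 + eta) / (2 * expR 1)) (divr_gt0 ln0 K0)) [N1 _ HN1] := z3.
  exists N1 => m n /HN1 /= hm.
  have [nm|/ltnW mn] := leqP n m; first by rewrite big_geq// subrr abs0 ltW.
  apply: le_trans (@abs_prod_sub1 _ (fun i => 2 * expR 1 * c i) _ _ _) _.
    by move=> i; exact: twisted_exp_le.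
  rewrite lerBlDl -[leRHS]lnK ?posrE ?addr_gt0// ler_expR -mulr_sumr.
  rewrite mulrC -ler_pdivlMr// -(sub_series_geq _ mn).
  have := nondecreasing_cvgn_le cnd z3 n.
  by have := ler_norm (limn (series c) - series c m); lra.
(* Two such products differ by at most [eta / 2 * abs l], while each has modulus at least
   [3 / 4 * abs l]; their quotient is therefore within [eta] of 1. *)
have [N2 HN2] : exists N2, forall n, (N2 <= n)%N -> abs (l - P n) <= eta / 4 * abs l.
  have /cvgrPdist_le/(_ (eta / 4 * abs l)%:C%C) := Pl.
  rewrite ltcR mulr_gt0 ?divr_gt0// => /(_ isT) [N2 _ HN2].
  by exists N2 => n /HN2; rewrite normE lecR.
pose M := maxn N1 N2.
pose W N := \sum_(0 <= n < N) w n.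
have HM n : abs (cxp (W (M + n)%N - W M) - 1) <= e.
  have -> : W (M + n)%N - W M = \sum_(M <= i < M + n) w i.
    by rewrite /W (big_cat_nat (leq0n M) (leq_addr n M))/= addrAC subrr add0r.
  rewrite (big_morph _ cxpD cxp0).
  have P0 k : P k != 0 by rewrite prodf_seq_neq0; apply/allP => i _ /=; rewrite invr_neq0.
  rewrite (_ : \prod_(_ <= i < _) _ = (\prod_(M <= i < M + n) F i) * (P (M + n)%N / P M)); last first.
    rewrite /P (big_cat_nat (leq0n M) (leq_addr n M))/= [X in _ * (X / _)]mulrC mulfK ?P0//.
    by rewrite -big_split /=; apply: eq_bigr => i _; rewrite /F mulrAC mulfV// mul1r.
  have hF := HN1 M (M + n)%N (leq_maxl _ _).
  have hP : abs (P (M + n)%N / P M - 1) <= eta.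
    have a0 : 0 < abs (P M) by rewrite abs_gt0.
    rewrite -[X in _ / _ - X](@divff _ (P M))// -mulrBl absM absV ler_pdivrMr//.
    have h1 := HN2 (M + n)%N (leq_trans (leq_maxr _ _) (leq_addr _ _)).
    have h2 := HN2 M (leq_maxr _ _).
    have h3 := absD (P (M + n)%N - l) (l - P M).
    have h4 := absD (l - P M) (P M).
    move: h3 h4; rewrite subrK (absB _ l) addrA subrK => h3 h4.
    have h5 : eta * abs l <= abs l by rewrite ler_piMl ?abs_ge0.
    have h6 : eta * (3 / 4 * abs l) <= eta * abs (P M).
      by rewrite ler_wpM2l ?(ltW eta0)//; lra.
    have h7 : 0 <= eta * abs l by rewrite mulr_ge0 ?abs_ge0 ?ltW.
    lra.
  apply: le_trans (abs_mul_sub1 _ _) _.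
  have h0 := abs_ge0 (\prod_(M <= i < M + n) F i - 1).
  have h1 := absD (P (M + n)%N / P M - 1) 1; move: h1; rewrite subrK abs1 => h1.
  have h2 := abs_ge0 (P (M + n)%N / P M).
  nra.
have ReImD (a b : R[i]) : complex.Im (a + b) = complex.Im a + complex.Im b by case: a b => ? ? [].
(* The exponential of the increment stays near 1 and the steps are at most 1, so
   the imaginary part cannot jump to another branch of the logarithm. *)
have Hn n : `|complex.Re (W (M + n)%N - W M)| <= 1 /\ `|complex.Im (W (M + n)%N - W M)| <= 1.
  elim: n => [|n [_ IH]]; first by rewrite addn0 subrr /= normr0 ler01.
  apply: He => //.
  have -> : W (M + n.+1)%N - W M = (W (M + n)%N - W M) + w (M + n)%N.
    by rewrite /W addnS big_nat_recr//= addrAC.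
  rewrite ReImD (le_trans (ler_normD _ _))//.
  have := le_trans (abs_Im _) (w1 (M + n)%N); lra.
exists (\sum_(0 <= n < M) abs (w n) + 2) => N.
rewrite -/(W N); have [MN|NM] := leqP M N.
  have [] := Hn (N - M)%N; rewrite subnKC// => hr hi.
  have := le_trans (abs_le_ReIm _) (lerD hr hi).
  have := absD (W N - W M) (W M); rewrite subrK => h1 h2.
  have := @abs_sum R _ (index_iota 0 M) xpredT w; rewrite -/(W M) /=; lra.
rewrite /W; apply: le_trans (abs_sum _ _ _ _) _ => /=.
rewrite (big_cat_nat (leq0n N) (ltnW NM))//= -addrA lerDl addr_ge0// sumr_ge0// => i _.
exact: abs_ge0.
Qed.
End LogBounded.

(** * Characters of a finite abelian group span its functions *)

Section CharacterSpan.
Variable F : numClosedFieldType.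

Lemma prim_root_exists n : (0 < n)%N -> exists z : F, n.-primitive_root z.
Proof.
move=> n0; have [r rE] := closed_field_poly_normal ('X^n - 1 : {poly F}).
move: rE; rewrite (monicP _) ?monicXnsubC// scale1r => rE.
have rsep : uniq r.
  by rewrite -separable_prod_XsubC -rE separable_Xn_sub_1// pnatr_eq0 -lt0n.
have rn : (n <= size r)%N.
  by rewrite -ltnS -(size_prod_XsubC r id) -rE size_XnsubC.
have rn1 : all n.-unity_root r.
  by apply/allP => z; rewrite -root_prod_XsubC -rE.
have /hasP[z _ zP] : has n.-primitive_root r by exact: has_prim_root.
by exists z.
Qed.

Lemma sum_prim_root n (w : F) j : n.-primitive_root w -> (j < n)%N ->
  \sum_(0 <= k < n) w^-1 ^+ j ^+ k = if j == 0%N then n%:R else 0.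
Proof.
move=> wP jn; have [->|j0] := eqVneq j 0%N.
  by under eq_bigr do rewrite expr0 expr1n; rewrite sumr_const_nat subn0.
have wj : w^-1 ^+ j != 1.
  rewrite exprVn invr_eq1 -(prim_order_dvd wP).
  by apply/negP => /dvdn_leq; rewrite lt0n j0 leqNgt jn => /(_ isT).
apply: (mulfI (_ : w^-1 ^+ j - 1 != 0)); first by rewrite subr_eq0.
rewrite mulr0 big_mkord -subrX1 -exprM mulnC exprM exprVn (prim_expr_order wP).
by rewrite invr1 expr1n subrr.
Qed.

Variable gT : finGroupType.
Hypothesis gC : commutative (@mulg gT).
Variable P : (gT -> F) -> Prop.
Hypothesis PZ : forall c f, P f -> P (fun x => c * f x).
Hypothesis PD : forall f g, P f -> P g -> P (fun x => f x + g x).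
Hypothesis Pchar : forall chi : gT -> F, chi 1%g = 1 ->
  (forall x y, chi (x * y)%g = chi x * chi y) -> P chi.

Lemma span0 : P (fun=> 0).
Proof.
have := PZ 0 _ (Pchar (fun=> 1) erefl (fun _ _ => esym (mulr1 1))).
by under eq_fun do rewrite mul0r.
Qed.

(** By induction on [s]: a function that is an eigenfunction along [s] is the sum of its projections
    to the eigenspaces of translation by one more element [g]. By commutativity each projection is
    still an eigenfunction along [s]. *)
Lemma eigenfunction_span (s : seq gT) :
  (forall f : gT -> F, (forall g, g \in s -> exists c, forall x, f (x * g)%g = c * f x) ->
     P f) ->
  forall f, P f.
Proof.
elim: s => [|g s IH] H; first by move=> f; apply: H.
apply: IH => f fs.
have n0 := order_gt0 g; set n := #[g]%g in n0.
have [w wP] := prim_root_exists _ n0.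
have w0 : w != 0.
  apply/eqP => w0; have /eqP := prim_expr_order wP.
  by rewrite w0 expr0n gtn_eqF// eq_sym oner_eq0.
(* The projections onto the eigenspaces of translation by [g]. *)
pose fk k x := n%:R^-1 * \sum_(0 <= j < n) w^-1 ^+ j ^+ k * f (x * g ^+ j)%g.
have fE : f = fun x => \sum_(0 <= k < n) fk k x.
  apply/funext => x; rewrite /fk -mulr_sumr exchange_big /=.
  under eq_big_nat => j /andP[_ jn] do rewrite -mulr_suml (sum_prim_root _ _ _ wP jn).
  rewrite big_ltn// big_nat big1 ?addr0 => [|j /andP[j0 _]]; last first.
    by rewrite eqn0Ngt j0 mul0r.
  by rewrite eqxx mulrA mulVf ?mul1r ?expg0 ?mulg1// pnatr_eq0 -lt0n.
have Pk k : P (fk k).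
  apply: H => b; rewrite inE => /predU1P[->|hs].
    exists (w ^+ k) => x; rewrite /fk mulrCA; congr (_ * _).
    (* Since [g] and [w] both have order [n], [h n = h 0], and the sum over a period is unchanged by
       the shift of [j]. *)
    pose h j := w^-1 ^+ j ^+ k * f (x * g ^+ j)%g.
    have -> : \sum_(0 <= j < n) h j = \sum_(0 <= j < n) h j.+1.
      apply: (@addrI _ (h n)); rewrite addrC -big_nat_recr//= big_nat_recl//=.
      congr (_ + _); rewrite /h expr0 expr1n mul1r expg0 mulg1 expg_order mulg1.
      by rewrite exprVn (prim_expr_order wP) invr1 expr1n mul1r.
    rewrite mulr_sumr; apply: eq_bigr => j _; rewrite /h exprS exprMn !mulrA.
    by rewrite [w^-1 ^+ k]exprVn mulfV ?expf_neq0// mul1r expgS mulgA.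
  have [c cE] := fs b hs; exists c => x.
  rewrite /fk mulrCA; congr (_ * _); rewrite mulr_sumr; apply: eq_bigr => j _.
  by rewrite mulrCA -cE -!mulgA (gC b).
rewrite fE; elim: (n) => [|m IH]; first by under eq_fun do rewrite big_geq//; exact: span0.
by under eq_fun do rewrite big_nat_recr//=; exact: PD.
Qed.

(** An eigenfunction of all translations is either zero or [f 1] times a character. The span is
    expressed as an induction principle: [P] is any property stable under linear combinations that
    holds for characters. *)
Lemma character_span f : P f.
Proof.
apply: (eigenfunction_span (enum gT)) => {}f fE.
have {}fE g : exists c, forall x, f (x * g)%g = c * f x by apply: fE; rewrite mem_enum.
have fM x y : f 1%g * f (x * y)%g = f x * f y.
  by have [c cE] := fE y; have fy := cE 1%g; rewrite mul1g in fy; rewrite cE fy; ring.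
have [f1|f1] := eqVneq (f 1%g) 0.
  suff -> : f = fun=> 0 by exact: span0.
  apply/funext => x; apply/eqP; rewrite -sqrf_eq0 expr2.
  by rewrite -fM f1 mul0r.
have -> : f = fun x => f 1%g * (f x / f 1%g) by apply/funext => x; rewrite mulrC divfK.
apply: PZ; apply: Pchar => [|x y]; first by rewrite divff.
by rewrite -[f (x * y)%g](mulKf f1) fM; field.
Qed.
End CharacterSpan.

(** * Partial summation and the weights [n^{-1/2}] *)

Section Summation.
Context {R : realType}.

(** Summation by parts writes the weighted sum as a boundary term plus partial sums of [a] times the
    nonnegative differences [u n - u n.+1]; each of these is dominated by its analogue for
    [C + \sum b]. *)
Lemma abel_comparison (a : nat -> R[i]) (b u : nat -> R) (C : R) :
  (forall n, 0 <= u n) -> (forall n, u n.+1 <= u n) ->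
  (forall N, abs (\sum_(0 <= n < N) a n) <= C + \sum_(0 <= n < N) b n) ->
  forall N, abs (\sum_(0 <= n < N) a n * (u n)%:C%C)
    <= C * u 0%N + \sum_(0 <= n < N) b n * u n.
Proof.
move=> u0 ud ab.
pose A N := \sum_(0 <= n < N) a n; pose B N := C + \sum_(0 <= n < N) b n.
have key N : abs (\sum_(0 <= n < N) a n * (u n)%:C%C - A N * (u N)%:C%C)
    <= C * u 0%N + \sum_(0 <= n < N) b n * u n - B N * u N.
  elim: N => [|N IH].
    by rewrite /A /B !big_geq// mul0r subrr abs0 !addr0 subrr.
  have -> : \sum_(0 <= n < N.+1) a n * (u n)%:C%C - A N.+1 * (u N.+1)%:C%C =
      (\sum_(0 <= n < N) a n * (u n)%:C%C - A N * (u N)%:C%C)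
      + A N.+1 * (u N - u N.+1)%:C%C.
    by rewrite /A !big_nat_recr//= rmorphB; ring.
  apply: le_trans (absD _ _) _; rewrite absM absR ger0_norm ?subr_ge0//.
  have h : abs (A N.+1) * (u N - u N.+1) <= B N.+1 * (u N - u N.+1).
    by rewrite ler_wpM2r ?subr_ge0//; exact: ab.
  have -> : C * u 0%N + \sum_(0 <= n < N.+1) b n * u n - B N.+1 * u N.+1 =
     (C * u 0%N + \sum_(0 <= n < N) b n * u n - B N * u N) + B N.+1 * (u N - u N.+1).
    by rewrite /B !big_nat_recr//=; ring.
  exact: lerD.
move=> N; have := key N.
have := absD (\sum_(0 <= n < N) a n * (u n)%:C%C - A N * (u N)%:C%C) (A N * (u N)%:C%C).
rewrite subrK [abs (A N * _)]absM absR (ger0_norm (u0 N)).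
have : abs (A N) * u N <= B N * u N by rewrite ler_wpM2r//; exact: ab.
lra.
Qed.

Definition isqrt (n : nat) : R := n%:R `^ (- 2^-1).

Lemma isqrtE n : isqrt n = (Num.sqrt n%:R)^-1.
Proof. by rewrite /isqrt powRN powR12_sqrt. Qed.

Lemma isqrt_ge0 n : 0 <= isqrt n.
Proof. exact: powR_ge0. Qed.

Lemma isqrt_sqr n : isqrt n ^+ 2 = n%:R^-1.
Proof. by rewrite isqrtE exprVn sqr_sqrtr. Qed.

(** The comparison starts at index 1 because [isqrt 0 = 0]. *)
Lemma isqrt_decr n : isqrt n.+2 <= isqrt n.+1.
Proof.
rewrite -(@ler_sqr _ (isqrt n.+2)) ?nnegrE ?isqrt_ge0// !isqrt_sqr.
by rewrite lef_pV2 ?posrE ?ltr0n// ler_nat.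
Qed.

Lemma isqrt_cube_sum N : \sum_(0 <= n < N) isqrt n ^+ 3 <= 3.
Proof.
have i0 : isqrt 0 = 0 by rewrite isqrtE sqrtr0 invr0.
have i1 : isqrt 1 = 1 by rewrite isqrtE sqrtr1 invr1.
case: N => [|[|N]]; first by rewrite big_geq.
  by rewrite big_nat1 i0 expr0n/=; lra.
(* Telescoping form of the bound, an equality for [N = 0]. With [x] and [y] consecutive weights, the
   induction step is [y^3 <= 2 * (x - y)], which follows from [x^2 - y^2 = x^2 * y^2] after
   multiplication by [x + y]. *)
suff : \sum_(0 <= n < N.+2) isqrt n ^+ 3 <= 3 - 2 * isqrt N.+1.
  by have := isqrt_ge0 N.+1; lra.
elim: N => [|N IH].
  by rewrite !big_nat_recr//= big_geq// i0 i1 expr1n expr0n/=; lra.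
rewrite big_nat_recr//=; apply: le_trans (lerD IH (lexx _)) _.
have := isqrt_ge0 N.+2; have := isqrt_decr N.
have : isqrt N.+1 ^+ 2 = isqrt N.+2 ^+ 2 + isqrt N.+1 ^+ 2 * isqrt N.+2 ^+ 2.
  rewrite !isqrt_sqr -[N.+2%:R]natr1; have : 0 < N.+1%:R :> R by rewrite ltr0n.
  set m : R := N.+1%:R => m0; field.
  by rewrite !gt_eqF//; lra.
set x := isqrt N.+1; set y := isqrt N.+2 => E yx y0.
rewrite -lerBlDl.
have [xy0|xy0] := eqVneq (x + y) 0.
  have -> : y = 0 by lra.
  have -> : x = 0 by lra.
  by rewrite expr0n/=; lra.
have p : 0 < x + y by rewrite lt_def xy0 addr_ge0// (le_trans y0).
suff : 0 <= 2 * (x - y) - y ^+ 3 by lra.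
rewrite -(pmulr_lge0 _ p).
have -> : (2 * (x - y) - y ^+ 3) * (x + y) = 2 * (x ^+ 2 - y ^+ 2) - y ^+ 3 * (x + y) by ring.
have -> : 2 * (x ^+ 2 - y ^+ 2) - y ^+ 3 * (x + y) = y ^+ 2 * (2 * x ^+ 2 - y * (x + y)).
  by rewrite {1}E; ring.
rewrite mulr_ge0 ?sqr_ge0//; nra.
Qed.

Lemma cvg_isqrt_cube : cvgn (series (fun n => isqrt n ^+ 3)).
Proof.
apply: nondecreasing_is_cvgn.
  by apply: nondecreasing_series => i _ _; rewrite exprn_ge0 ?isqrt_ge0.
by exists 3 => _ [N _ <-]; exact: isqrt_cube_sum.
Qed.
End Summation.

(** * Prime sums of a single character *)

Section Dirichlet.
Context {R : realType} {q : nat}.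
Notation G := {unit 'Z_q}.
Implicit Types chi : 'Z_q -> R[i].

(** Evaluating the local factorisation at [1/2] itself excludes a positive exponent, and the default
    value of [ord_at] is 0 as well. *)
Lemma m_chi_eq0 (chi : 'Z_q -> Cplx R) : dirichlet_L chi 2^-1 != 0 -> m_chi chi = 0%N.
Proof.
move=> L0; rewrite /m_chi /ord_at; case: xgetP => // n _ [g [_ _ /nbhs_singleton E]].
by case: n E => // n; rewrite subrr expr0n mul0r => E; rewrite E eqxx in L0.
Qed.

Lemma abs_character_le1 chi x : dirichlet_character chi -> abs (chi x) <= 1.
Proof.
move=> [c1 cM cU].
have [ux|ux] := boolP (x \is a GRing.unit); last first.
  by have := cU x; rewrite (negbTE ux) => /negbFE/eqP ->; rewrite abs0.
pose g : G := FinRing.unit 'Z_q ux.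
have cX k : chi (x ^+ k) = chi x ^+ k.
  by elim: k => [|k IH]; rewrite ?expr0// !exprS cM IH.
have xo : x ^+ #[g]%g = 1.
  by have := congr1 val (expg_order g); rewrite FinRing.val_unitX.
have := congr1 abs (cX #[g]%g); rewrite xo c1 abs1 absX => /esym/eqP.
by rewrite pexpr_eq1 ?order_gt0 ?abs_ge0// => /eqP ->.
Qed.

Definition prime_term chi n : R[i] :=
  if prime n then chi n%:R * (isqrt n)%:C%C else 0.

Definition prime_sum chi N := \sum_(0 <= n < N) prime_term chi n.

(* The sum of [chi(p) / p] over the primes [p < N]. *)
Definition prime_sum1 chi N :=
  \sum_(0 <= n < N) prime_term chi n * (isqrt n)%:C%C.

Lemma prime_term_sqr chi n : prime_term chi n ^+ 2 =
  prime_term (fun x => chi x ^+ 2) n * (isqrt n)%:C%C.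
Proof.
by rewrite /prime_term; case: ifP => _; rewrite ?mul0r ?expr0n//; ring.
Qed.

Lemma abs_prime_term chi n : dirichlet_character chi -> abs (prime_term chi n) <= isqrt n.
Proof.
move=> dchi; rewrite /prime_term; case: ifP => _; last by rewrite abs0 isqrt_ge0.
rewrite absM absR ger0_norm ?isqrt_ge0//.
by rewrite ler_piMl ?isqrt_ge0//; exact: abs_character_le1.
Qed.

Lemma abs_prime_sum1 chi N : dirichlet_character chi ->
  abs (prime_sum1 chi N) <= \sum_(0 <= n < N) n%:R^-1.
Proof.
move=> dchi; apply: le_trans (abs_sum _ _ _ _) _.
apply: ler_sum => n _; rewrite absM absR ger0_norm ?isqrt_ge0// -isqrt_sqr expr2.
by rewrite ler_wpM2r ?isqrt_ge0//; exact: abs_prime_term.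
Qed.

Lemma prime_sum_sqr_bounded (chi : 'Z_q -> Cplx R) : dirichlet_character chi -> m_chi chi = 0%N ->
  DRH_A chi -> exists C : R, forall N,
    abs (prime_sum chi N + prime_sum1 (fun x => chi x ^+ 2) N / 2) <= C.
Proof.
move=> dchi m0 [l [l0 hl]].
have [||//||C HC] := @euler_log_bounded R (prime_term chi) l.
- move=> n; rewrite /prime_term; case: ifP => pn; last first.
    by rewrite abs0 expr0n/= invr_ge0.
  have := @abs_prime_term chi n dchi; rewrite /prime_term pn => h.
  apply: (@le_trans _ _ (isqrt n ^+ 2)); first by rewrite ler_sqr ?nnegrE ?abs_ge0 ?isqrt_ge0.
  by rewrite isqrt_sqr lef_pV2 ?posrE ?ltr0n ?prime_gt0// (ler_nat _ 2) prime_gt1.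
- apply: (series_le_cvg _ _ _ cvg_isqrt_cube) => n; rewrite ?exprn_ge0 ?abs_ge0 ?isqrt_ge0//.
  by rewrite lerXn2r ?nnegrE ?abs_ge0 ?isqrt_ge0//; exact: abs_prime_term.
(* At [x = N] the Euler product includes [p = N], so it is the partial product over indices below
   [N.+1]. *)
- rewrite -(cvg_shiftS _).
  have := cvg_comp _ _ (@cvgr_idn R) hl.
  apply: cvg_trans; apply: near_eq_cvg; near=> N.
  rewrite /= /DRH_product m0 expr0 mul1r natrK big_mkcond.
  apply: eq_big_nat => n /andP[_ nN] /=.
  rewrite ler_nat -ltnS nN andbT /prime_term; case: ifP => //.
  by rewrite subr0 invr1.
exists C => N; have := HC N; rewrite big_split /= -mulr_suml.
by under [X in _ + X / _]eq_bigr do rewrite prime_term_sqr.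
Unshelve. all: by end_near. Qed.

(** The trivial bound on the sum of [chi(p)^2 / p] gives [|prime_sum chi N| <= C + 1/2 \sum 1/n],
    whether or not [chi^2] is trivial. Partial summation against [n^{-1/2}] turns the harmonic sum
    into the convergent sum of [n^{-3/2}]. *)
Lemma prime_sum1_bounded (chi : 'Z_q -> Cplx R) : dirichlet_character chi -> m_chi chi = 0%N ->
  DRH_A chi -> exists C : R, forall N, abs (prime_sum1 chi N) <= C.
Proof.
move=> dchi m0 hD; have [C HC] := prime_sum_sqr_bounded chi dchi m0 hD.
have d2 : dirichlet_character (fun x => chi x ^+ 2 : Cplx R).
  have [c1 cM cU] := dchi; split => [|x y|x]; first by rewrite c1 expr1n.
    by rewrite cM exprMn.
  by rewrite sqrf_eq0 cU.
pose b n : R := n%:R^-1 / 2.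
have t0 : prime_term chi 0 = 0 by [].
(* Indices are shifted by one because [isqrt] decreases only from 1 on; the term at 0 vanishes. *)
have A N : abs (\sum_(0 <= n < N) prime_term chi n.+1) <= C + \sum_(0 <= n < N) b n.+1.
  have -> : \sum_(0 <= n < N) prime_term chi n.+1 = prime_sum chi N.+1.
    by rewrite /prime_sum big_nat_recl// t0 add0r.
  have h1 := HC N.+1.
  have h2 := abs_prime_sum1 _ N.+1 d2.
  set X := prime_sum1 _ _ in h1 h2.
  have := absD (prime_sum chi N.+1 + X / 2) (- (X / 2)); rewrite addrK absN absM abs_half.
  move: h2; rewrite big_nat_recl//= invr0 add0r /b -mulr_suml.
  lra.
exists (C + 3 / 2) => N.
have := abel_comparison (fun n => prime_term chi n.+1) (fun n => b n.+1) (fun n => isqrt n.+1) C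
  (fun n => isqrt_ge0 n.+1) isqrt_decr A.
case: N => [|N] H.
  have := A 0%N; rewrite /prime_sum1 !big_geq// abs0 addr0; lra.
rewrite /prime_sum1 big_nat_recl// t0 mul0r add0r.
apply: le_trans (H N) _; rewrite {1}isqrtE sqrtr1 invr1 mulr1 lerD2l.
have := @isqrt_cube_sum R N.+1; rewrite big_nat_recl//.
have -> : \sum_(0 <= n < N) b n.+1 * isqrt n.+1 = (\sum_(0 <= n < N) isqrt n.+1 ^+ 3) / 2.
  rewrite mulr_suml; apply: eq_bigr => n _.
  by rewrite /b exprSr isqrt_sqr; ring.
have : 0 <= isqrt 0 ^+ 3 :> R by rewrite exprn_ge0 ?isqrt_ge0.
lra.
Qed.

End Dirichlet.

(** * Functions on the unit group and their prime sums *)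

Section Units.
Context {R : realType} {q : nat}.
Notation G := {unit 'Z_q}.
Implicit Types (f : G -> R[i]).

Definition ext0 f : 'Z_q -> R[i] := fun x => oapp f 0 (insub x).

Lemma ext0_val f (g : G) : ext0 f (val g) = f g.
Proof. by rewrite /ext0 valK. Qed.

Lemma ext0_nunit f x : x \isn't a GRing.unit -> ext0 f x = 0.
Proof. by move=> ux; rewrite /ext0 insubN. Qed.

Lemma ext0_linear c f h x : ext0 (fun g => c * f g + h g) x = c * ext0 f x + ext0 h x.
Proof. by rewrite /ext0; case: insubP => [g _ _|_] //=; rewrite mulr0 addr0. Qed.

Lemma ext0_character f : f 1%g = 1 -> (forall x y, f (x * y)%g = f x * f y) ->
  dirichlet_character (ext0 f : 'Z_q -> Cplx R).
Proof.
move=> f1 fM; split => [|x y|x].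
- by rewrite -[1 in LHS]/(val (1%g : G)) ext0_val.
- have [ux|ux] := boolP (x \is a GRing.unit); last first.
    by rewrite (ext0_nunit _ _ ux) mul0r ext0_nunit// unitrM negb_and ux.
  have [uy|uy] := boolP (y \is a GRing.unit); last first.
    by rewrite (ext0_nunit _ _ uy) mulr0 ext0_nunit// unitrM negb_and uy orbT.
  pose gx : G := FinRing.unit 'Z_q ux; pose gy : G := FinRing.unit 'Z_q uy.
  rewrite -[x]/(val gx) -[y]/(val gy) -[val gx * val gy]/(val (gx * gy)%g).
  by rewrite !ext0_val fM.
- have [ux|ux] := boolP (x \is a GRing.unit); last by rewrite ext0_nunit// eqxx.
  pose gx : G := FinRing.unit 'Z_q ux.
  rewrite -[x]/(val gx) ext0_val; apply/eqP => f0.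
  by have := fM gx gx^-1%g; rewrite mulgV f1 f0 mul0r => /eqP; rewrite oner_eq0.
Qed.

Lemma ext0_principal : ext0 (fun=> 1) = principal_character.
Proof.
apply/funext => x; rewrite /principal_character.
have [ux|ux] := boolP (x \is a GRing.unit); last by rewrite ext0_nunit.
by rewrite -[x]/(val (FinRing.unit 'Z_q ux)) ext0_val.
Qed.

Lemma ext0_inj f h : ext0 f = ext0 h -> f = h.
Proof. by move=> E; apply/funext => g; rewrite -!ext0_val E. Qed.

Lemma ext0_sqr f : (fun x => ext0 f x ^+ 2) = ext0 (fun g => f g ^+ 2).
Proof. by apply/funext => x; rewrite /ext0; case: insub => //=; rewrite expr0n. Qed.

(** This is the coefficient of the trivial character in the expansion of [f]. *)
Definition mean f : R[i] := #|{: G}|%:R^-1 * \sum_(g : G) f g.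

Lemma mean_linear c f h : mean (fun g => c * f g + h g) = c * mean f + mean h.
Proof. by rewrite /mean big_split /= -mulr_sumr; ring. Qed.

Lemma mean1 : mean (fun=> 1) = 1.
Proof.
by rewrite /mean sumr_const mulVf// pnatr_eq0 -lt0n; apply/card_gt0P; exists 1%g.
Qed.

(** Translation by an element [g] with [f g != 1] preserves the sum and also multiplies it by
    [f g]. *)
Lemma mean_character f : (forall x y, f (x * y)%g = f x * f y) -> f <> (fun=> 1) -> f 1%g = 1 ->
  mean f = 0.
Proof.
move=> fM fn1 f1; have [g fg] : exists g, f g != 1.
  apply/not_existsP => H; apply: fn1; apply/funext => g.
  by have /negP := H g; rewrite negbK => /eqP.
apply: (mulfI (_ : f g - 1 != 0)); first by rewrite subr_eq0.
rewrite mulr0 mulrBl mul1r; apply/eqP; rewrite subr_eq0; apply/eqP.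
rewrite /mean mulrCA; congr (_ * _); rewrite mulr_sumr.
rewrite [RHS](reindex_inj (mulgI g)) /=.
by apply: eq_bigr => x _; rewrite fM.
Qed.

Lemma mulg_unitC (x y : G) : (x * y)%g = (y * x)%g.
Proof. by apply: val_inj; rewrite /= mulrC. Qed.

Lemma prime_sum_linear c (a b : 'Z_q -> R[i]) N :
  prime_sum (fun x => c * a x + b x) N = c * prime_sum a N + prime_sum b N.
Proof.
rewrite /prime_sum mulr_sumr -big_split /=; apply: eq_bigr => n _.
by rewrite /prime_term; case: ifP => _; [ring|rewrite mulr0 addr0].
Qed.

(* [mean (f o sqr) - mean f] is the sum of the coefficients in [f] of the nontrivial
   characters with [chi ^ 2 = 1], the only ones with an unbounded prime sum. *)
Lemma prime_sum_asymptotics :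
  (forall chi : 'Z_q -> Cplx R, nontrivial_characters chi -> DRH_A chi /\ m_chi chi = 0%N) ->
  forall f, exists C : R, forall N,
    abs (prime_sum (ext0 f) N - mean f * prime_sum (ext0 (fun=> 1)) N
       + (mean (fun g => f (g * g)%g) - mean f) / 2 * prime_sum1 (ext0 (fun=> 1)) N) <= C.
Proof.
move=> H; pose E f N := prime_sum (ext0 f) N - mean f * prime_sum (ext0 (fun=> 1)) N
  + (mean (fun g => f (g * g)%g) - mean f) / 2 * prime_sum1 (ext0 (fun=> 1)) N.
suff: forall f, exists C : R, forall N, abs (E f N) <= C by [].
have EL c f h N : E (fun g => c * f g + h g) N = c * E f N + E h N.
  rewrite /E !mean_linear (_ : ext0 _ = fun x => c * ext0 f x + ext0 h x); last first.
    by apply/funext => x; exact: ext0_linear.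
  by rewrite prime_sum_linear; ring.
have Echar chi : chi 1%g = 1 -> (forall x y, chi (x * y)%g = chi x * chi y) ->
    exists C : R, forall N, abs (E chi N) <= C.
  move=> c1 cM; have [->|cn1] := pselect (chi = fun=> 1).
    by exists 0 => N; rewrite /E mean1 subrr !mul0r addr0 mul1r subrr abs0.
  have nontriv (k : G -> R[i]) : k 1%g = 1 -> (forall x y, k (x * y)%g = k x * k y) ->
      k <> (fun=> 1) -> nontrivial_characters (ext0 k : 'Z_q -> Cplx R).
    move=> k1 kM kn1; split; first exact: ext0_character.
    by rewrite -ext0_principal => /ext0_inj.
  have [hD hm] := H _ (nontriv _ c1 cM cn1).
  have [C HC] := prime_sum_sqr_bounded _ (ext0_character _ c1 cM) hm hD.
  have c2E : (fun g => chi (g * g)%g) = (fun g => chi g ^+ 2).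
    by apply/funext => g; rewrite cM expr2.
  have c2M x y : chi (x * y)%g ^+ 2 = chi x ^+ 2 * chi y ^+ 2 by rewrite cM exprMn.
  have c21 : chi 1%g ^+ 2 = 1 by rewrite c1 expr1n.
  have {}HC N : abs (prime_sum (ext0 chi) N + prime_sum1 (ext0 (fun g => chi g ^+ 2)) N / 2) <= C.
    by rewrite -ext0_sqr; exact: HC.
  rewrite /E mean_character// c2E.
  (* For [chi^2 = 1] the coefficient of [prime_sum1] in [E] is [1/2], exactly the quadratic term of
     the logarithm; otherwise it is 0, and the quadratic term is itself bounded. *)
  have [c2|c2] := pselect ((fun g => chi g ^+ 2) = fun=> 1).
    exists C => N; have := HC N; rewrite c2 mean1 mul0r !subr0.
    by rewrite (mulrC _ 2^-1) mul1r.
  have [hD2 hm2] := H _ (nontriv _ c21 c2M c2).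
  have [C2 HC2] := prime_sum1_bounded _ (ext0_character _ c21 c2M) hm2 hD2.
  exists (C + C2) => N; rewrite (mean_character (fun g => chi g ^+ 2))//.
  rewrite subrr !mul0r subr0 addr0.
  have := absD (prime_sum (ext0 chi) N + prime_sum1 (ext0 (fun g => chi g ^+ 2)) N / 2)
    (- (prime_sum1 (ext0 (fun g => chi g ^+ 2)) N / 2)).
  rewrite addrK absN absM abs_half.
  by have := HC N; have := HC2 N; have := abs_ge0 (prime_sum1 (ext0 (fun g => chi g ^+ 2)) N); lra.
apply: (character_span _ _ mulg_unitC) => // [c f [C HC]|f h [C HC] [D HD]].
- exists (abs c * C) => N.
  have -> : E (fun x => c * f x) N = c * E f N.
    (* Homogeneity is read off from [EL] with [h = 0], where [E] vanishes at 0 because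
       [0 = -1 * f + f]. *)
    have := EL c f (fun=> 0) N; under eq_fun do rewrite addr0.
    move=> ->; have := EL (-1) f f N.
    under eq_fun do rewrite mulN1r addNr.
    by move=> ->; rewrite mulN1r addNr addr0.
  by rewrite absM ler_wpM2l ?abs_ge0.
- exists (C + D) => N.
  have := EL 1 f h N; under eq_fun do rewrite mul1r.
  by move=> ->; rewrite mul1r (le_trans (absD _ _))// lerD.
Qed.

(** * Residue classes and the number of square roots *)

Definition point_mass (a : G) : G -> R[i] := fun g => (g == a)%:R.

Lemma mean_point_mass a : mean (point_mass a) = #|{: G}|%:R^-1.
Proof.
rewrite /mean (bigD1 a)//= big1 /point_mass => [|g /negbTE ->//].
by rewrite eqxx addr0 mulr1.
Qed.

(** Up to the factor [1 / #|G|] each side counts square roots: there are none for a non-residue, and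
    multiplication by [c] maps the square roots of 1 bijectively to those of [c^2]. *)
Lemma mean_point_mass_sqr (a b : G) :
  (quadratic_residue a /\ quadratic_residue b) \/
  (~ quadratic_residue a /\ ~ quadratic_residue b) ->
  mean (fun g => point_mass a (g * g)%g) = mean (fun g => point_mass b (g * g)%g).
Proof.
have res c : mean (fun g => point_mass (c * c)%g (g * g)%g) =
    mean (fun g => point_mass 1%g (g * g)%g).
  rewrite /mean; congr (_ * _); rewrite (reindex_inj (mulgI c)) /=.
  apply: eq_bigr => g _; rewrite /point_mass (_ : (c * g * (c * g)) = (c * c) * (g * g))%g; last first.
    by rewrite !mulgA (mulg_unitC (c * g)%g c) mulgA.
  by rewrite -[X in (_ == X)%:R]mulg1 (inj_eq (mulgI _)).
have nres c : ~ quadratic_residue c -> mean (fun g => point_mass c (g * g)%g) = 0.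
  move=> nc; rewrite /mean big1 ?mulr0// => g _; rewrite /point_mass.
  by case: eqP => // E; case: nc; exists g; rewrite expgS expg1.
case=> -[]; last by move=> /nres -> /nres ->.
by move=> [c ->] [d ->]; rewrite !expgS !expg0 !mulg1 !res.
Qed.

Definition class_sum (a : G) N : R :=
  \sum_(0 <= p < N | prime p && ((p%:R : 'Z_q) == val a)) isqrt p.

Lemma prime_sum_point_mass a N : prime_sum (ext0 (point_mass a)) N = (class_sum a N)%:C%C.
Proof.
rewrite /prime_sum /class_sum [in RHS]big_mkcond rmorph_sum.
apply: eq_bigr => p _; rewrite /prime_term; case: (prime p) => //=.
have [->|pa] := eqVneq (p%:R : 'Z_q) (val a).
  by rewrite ext0_val /point_mass eqxx mul1r.
have [up|up] := boolP ((p%:R : 'Z_q) \is a GRing.unit); last by rewrite ext0_nunit ?mul0r.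
rewrite -[p%:R]/(val (FinRing.unit 'Z_q up)) ext0_val /point_mass.
case: eqP => [E|_]; last by rewrite mul0r.
by rewrite -E eqxx in pa.
Qed.

Lemma pi_s_class_sum (x : R) : exists N, forall a : G, pi_s 2^-1 x a = class_sum a N.
Proof.
(* The condition [p < x] is strict, so the index [t] counts only when [x] exceeds its truncation. *)
pose t := Num.truncn x; exists (if t%:R < x then t.+1 else t) => a.
rewrite /pi_s /class_sum -/t ![LHS]big_mkcond ![RHS]big_mkcond; case: ifP => tx.
  apply: eq_big_nat => p /andP[_ pt].
  by rewrite (le_lt_trans _ tx)// ler_nat -ltnS.
rewrite big_nat_recr//= tx andbF addr0; apply: eq_big_nat => p /andP[_ pt].
have px : p%:R < x by rewrite (@lt_le_trans _ _ p.+1%:R) ?ltr_nat// -truncn_gt_nat.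
by rewrite px.
Qed.

End Units.

Theorem corollary3p3 (R : realType) (q : nat) (hq : (3 <= q)%N)
    (hDRH : forall chi : 'Z_q -> Cplx R,
      nontrivial_characters chi -> DRH_A chi)
    (hL : forall chi : 'Z_q -> Cplx R,
      nontrivial_characters chi -> dirichlet_L chi 2^-1 != 0)
    (hm : forall a : {unit 'Z_q}, m_sigma a = 0 :> Cplx R)
    (a b : {unit 'Z_q})
    (hab : (quadratic_residue a /\ quadratic_residue b) \/
           (~ quadratic_residue a /\ ~ quadratic_residue b)) :
  (fun x : R => pi_s 2^-1 x b - pi_s 2^-1 x a : R^o)
    =O_ (FilterType (pinfty_nbhs R) _) (fun=> 1 : R^o).
Proof.
have H (chi : 'Z_q -> Cplx R) : nontrivial_characters chi -> DRH_A chi /\ m_chi chi = 0%N.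
  by move=> nchi; split; [exact: hDRH|exact/m_chi_eq0/hL].
(* For this difference of indicators both main terms vanish: the two means agree, and so do the
   means after squaring. *)
have [C HC] := prime_sum_asymptotics H (fun g => -1 * point_mass a g + point_mass b g).
have bound x : `|pi_s 2^-1 x b - pi_s 2^-1 x a| <= C.
  have [N HN] := pi_s_class_sum (q := q) x; have := HC N.
  rewrite !HN !mean_linear !mean_point_mass (mean_point_mass_sqr a b)//.
  rewrite (_ : ext0 _ = fun z => -1 * ext0 (point_mass a) z + ext0 (point_mass b) z); last first.
    by apply/funext => z; exact: ext0_linear.
  rewrite prime_sum_linear !prime_sum_point_mass !mulN1r !addNr subrr !mul0r subr0 addr0.
  by rewrite addrC -rmorphB absR.
(* The bound [C] holds for every [x]; the maximum with 1 only makes the constant positive. *)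
apply/eqO_exP; exists (Num.max C 1); first by rewrite lt_max ltr01 orbT.
near=> x; rewrite normr1 mulr1 le_max; apply/orP; left; exact: bound.
Unshelve. all: by end_near. Qed.
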